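(* Let $H$ be a complex Hilbert space, let $L_0$ be a (densely defined) symmetric minimal operator in $H$, let $\widehat{L}=L_0^*$ be the corresponding maximal operator, let $L$ be a self-adjoint correct extension of $L_0$, and let $L_K$ be a correct restriction of $\widehat{L}$, with $$L_K^{-1}f=L^{-1}f+Kf,\qquad f\in H,$$ where $K$ is a bounded linear operator on $H$ with $R(K)\subset \operatorname{Ker}\widehat{L}$. If $R(K^* )\subset D(L)$, $I+KL\ge 0$, and $I+KL$ is invertible, then the spectrum of $L_K$ is real, that is, $\sigma(L_K)\subset\mathbb{R}$.
   Context: $D(\cdot)$, $R(\cdot)$, $\operatorname{Ker}$ denote domain, range and kernel; $I$ is the identity on $H$. A linear operator $A$ in $H$ is correctly solvable if there is $C>0$ with $\|u\|\le C\|Au\|$ for all $u\in D(A)$, and everywhere solvable if $R(A)=H$; $A$ is a correct operator if both hold (so $A^{-1}$ is a bounded operator defined on all of $H$). A correctly solvable operator $L_0$ is minimal if $\overline{R(L_0)}\ne H$. A closed operator $\widehat{L}$ is maximal if $R(\widehat{L})=H$ and $\operatorname{Ker}\widehat{L}\neq\{0\}$. $A$ is a restriction of $B$ (and $B$ an extension of $A$) if $D(A)\subset D(B)$ and $Au=Bu$ for $u\in D(A)$. A correct extension of $L_0$ (correct restriction of $\widehat L$) is an extension of $L_0$ (restriction of $\widehat L$) that is a correct operator. Every correct restriction $L_K$ of $\widehat{L}$ has inverse $L_K^{-1}=L^{-1}+K$ for a bounded linear operator $K$ from $H$ into $\operatorname{Ker}\widehat{L}$, and then $D(L_K)=\{u\in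 D(\widehat{L}): (I-K\widehat{L})u\in D(L)\}$. When $R(K^* )\subset D(L)$ (with $L=L^*$), the operator $KL$, defined on the dense set $D(L)$, is bounded there; $KL$ denotes its bounded extension (closure) to all of $H$. For a bounded operator $T$ on $H$, $T\ge 0$ means $(Tx,x)\ge 0$ for all $x\in H$, and invertible means having a bounded inverse defined on all of $H$. *)

(* Defs.v *)
From mathcomp Require Import all_boot all_order all_algebra.
From mathcomp Require Import all_classical all_reals all_analysis.
From mathcomp Require Import complex.
Set Implicit Arguments.
Unset Strict Implicit.
Unset Printing Implicit Defensive.
Import Order.TTheory GRing.Theory Num.Theory.
Import numFieldNormedType.Exports.
Local Open Scope classical_set_scope.
Local Open Scope ring_scope.
Local Open Scope complex_scope.

(* The scalars are R[i] with R : realType, and a complex Hilbert space is a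
   complete normed module over R[i] together with a positive definite Hermitian
   form inducing its norm. The form is linear in its first argument. *)
Definition induces_norm (R : realType) (H : completeNormedModType R[i])
    (dot : {dot H for Num.conj}) : Prop :=
  forall x : H, `|x| ^+ 2 = dot x x.

(* An operator in H need not be everywhere defined. It is given by a domain and
   a total function whose values off the domain are junk, so operators are
   compared through their graphs (op_eq), never by Leibniz equality. *)
Record op (H : Type) := Op { dom : set H; op_fun :> H -> H }.

Definition graph (H : Type) (A : op H) : set (H * H) :=
  [set p | dom A p.1 /\ A p.1 = p.2].

Definition op_eq (H : Type) (A B : op H) : Prop := graph A = graph B.

Definition op_range (H : Type) (A : op H) : set H := A @` dom A.

Definition restriction (H : Type) (A B : op H) : Prop :=
  dom A `<=` dom B /\ forall u, dom A u -> A u = B u.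

Definition op_total (H : Type) (f : H -> H) : op H := Op setT f.

Definition op_add (H : nmodType) (A B : op H) : op H :=
  Op (dom A `&` dom B) (fun u => A u + B u).

Definition op_comp (H : Type) (A B : op H) : op H :=
  Op [set u | dom B u /\ dom A (B u)] (fun u => A (B u)).

(* Meaningful when A is injective on its domain. *)
Definition op_inv (H : pointedType) (A : op H) : op H :=
  Op (op_range A) (fun f => get [set u | dom A u /\ A u = f]).

(* The operator whose graph is the closure of the graph of A; meaningful when A
   is closable. By op_closure_total below, when A is densely defined and has a
   bounded extension to the whole of H, this is that extension. *)
Definition op_closure (R : realType) (H : completeNormedModType R[i])
    (A : op H) : op H :=
  Op [set u | exists v, closure (graph A) (u, v)]
     (fun u => get [set v | closure (graph A) (u, v)]).

Lemma op_closure_total (R : realType) (H : completeNormedModType R[i])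
    (A : op H) (T : {linear H -> H}) :
  continuous T -> dense (dom A) -> restriction A (op_total T) ->
  op_eq (op_closure A) (op_total T).
Proof.
move=> cT dA [_ AT].
have cl u v : closure (graph A) (u, v) <-> v = T u.
  split=> [cuv|->].
    apply: contrapT => nv.
    have : closed [set p : H * H | T p.1 - p.2 = 0].
      have cB : continuous (fun p : H * H => T p.1 - p.2).
        move=> p; apply: (@cvgB _ _ _ (nbhs p) _ (T \o fst) snd); last exact: cvg_snd.
        by apply: continuous_comp; [exact: cvg_fst|exact: cT].
      have c0 : closed [set (0 : H)].
        exact/accessible_closed_set1/hausdorff_accessible/norm_hausdorff.
      exact: (proj1 (continuous_closedP _) cB _ c0).
    move=> h; apply: nv; apply/esym/subr0_eq; apply: (h (u, v)).
    apply: (closure_subset _ cuv) => -[x y] [/= dx <-].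
    by rewrite AT//= subrr.
  move=> B nB.
  have : nbhs u [set x | B (x, T x)].
    have h : (fun x => (x, T x)) @ u --> (u, T u).
      by apply: cvg_pair; [exact: cvg_id|exact: cT].
    exact: (h B nB).
  rewrite nbhsE => -[V [oV Vu] VB].
  have [x [Vx dx]] : V `&` dom A !=set0 by apply: dA => //; exists u.
  by exists (x, T x); split; [split=> /=; rewrite ?AT|exact: VB].
have gT u : get [set v | closure (graph A) (u, v)] = T u.
  by apply/cl; apply: (@getI _ [set v | closure (graph A) (u, v)] (T u)); apply/cl.
rewrite /op_eq predeqE => -[u v] /=; split=> [[/= _ <-]|[_ /= <-]]; split=> //=.
- by exists (T u); apply/cl.
Qed.

Definition linear_op (R : realType) (H : completeNormedModType R[i])
    (A : op H) : Prop :=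
  [/\ dom A 0,
      forall (a : R[i]) (u v : H), dom A u -> dom A v -> dom A (a *: u + v) &
      forall (a : R[i]) (u v : H), dom A u -> dom A v ->
        A (a *: u + v) = a *: A u + A v].

Definition op_ker (H : nmodType) (A : op H) : set H :=
  [set u | dom A u /\ A u = 0].

Definition bounded_op (R : realType) (H : completeNormedModType R[i])
    (A : op H) : Prop :=
  exists C : R, forall u, dom A u -> `|A u| <= C%:C * `|u|.

Definition closed_op (R : realType) (H : completeNormedModType R[i])
    (A : op H) : Prop :=
  closed (graph A).

Definition correctly_solvable (R : realType) (H : completeNormedModType R[i])
    (A : op H) : Prop :=
  exists2 C : R, 0 < C & forall u, dom A u -> `|u| <= C%:C * `|A u|.

Definition everywhere_solvable (H : Type) (A : op H) : Prop :=
  op_range A = setT.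

Definition correct_op (R : realType) (H : completeNormedModType R[i])
    (A : op H) : Prop :=
  correctly_solvable A /\ everywhere_solvable A.

Definition minimal_op (R : realType) (H : completeNormedModType R[i])
    (A : op H) : Prop :=
  correctly_solvable A /\ closure (op_range A) <> setT.

Definition maximal_op (R : realType) (H : completeNormedModType R[i])
    (A : op H) : Prop :=
  [/\ closed_op A, op_range A = setT & op_ker A <> [set 0]].

(* Meaningful when A is densely defined: the value at v is then unique. *)
Definition op_adj (R : realType) (H : completeNormedModType R[i])
    (dot : {dot H for Num.conj}) (A : op H) : op H :=
  let adj_at v := [set w | forall u, dom A u -> dot (A u) v = dot u w] in
  Op [set v | exists w, adj_at v w] (fun v => get (adj_at v)).

Definition symmetric_op (R : realType) (H : completeNormedModType R[i])
    (dot : {dot H for Num.conj}) (A : op H) : Prop :=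
  dense (dom A) /\
  forall u v, dom A u -> dom A v -> dot (A u) v = dot u (A v).

Definition self_adjoint (R : realType) (H : completeNormedModType R[i])
    (dot : {dot H for Num.conj}) (A : op H) : Prop :=
  dense (dom A) /\ op_eq A (op_adj dot A).

(* The order of R[i] is such that 0 <= z forces z to be real. *)
Definition nonneg_op (R : realType) (H : completeNormedModType R[i])
    (dot : {dot H for Num.conj}) (A : op H) : Prop :=
  forall u, dom A u -> 0 <= dot (A u) u.

Definition invertible_op (R : realType) (H : completeNormedModType R[i])
    (A : op H) : Prop :=
  [/\ set_inj (dom A) A, dom (op_inv A) = setT & bounded_op (op_inv A)].

Definition spectrum (R : realType) (H : completeNormedModType R[i])
    (A : op H) : set R[i] :=
  [set z | ~ invertible_op (op_add A (op_total (fun u : H => - (z *: u))))].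

(* Main.v *)
Require Import Defs.
From mathcomp Require Import all_boot all_order all_algebra.
From mathcomp Require Import all_classical all_reals all_analysis.
From mathcomp Require Import complex ring lra.
Set Implicit Arguments.
Unset Strict Implicit.
Unset Printing Implicit Defensive.
Import Order.TTheory GRing.Theory Num.Theory.
Import numFieldNormedType.Exports.
Local Open Scope classical_set_scope.
Local Open Scope ring_scope.
Local Open Scope complex_scope.

(** Write [S] for [I + KL] and [L_K^-1 = L^-1 + K = S L^-1].  Hence
    [L_K] sends [S u] to [L u] for [u] in [D(L)], and [L_K - z] is invertible
    as soon as the pencil [L - z S] on [D(L)] is bounded below and onto, and [S]
    is bounded.

    Suppose that [S] is bounded, symmetric and coercive, [<Su,u> >= c |u|^2] with
    [c > 0].  Both [<Lu,u>] and [<Su,u>] are real, so the imaginary part of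
    [<(L - z S)u,u>] is [- Im z <Su,u>], of size at least [|Im z| c |u|^2]: for
    [Im z <> 0] the pencil is bounded below ([pencil_bounded_below]).  Applied at
    the conjugate of [z], the same bound makes [u |-> <u,f>] a functional
    controlled by [|(L - z^* S) u|]; representing it as
    [u |-> <(L - z^* S)u,w>] and using that [L] is self-adjoint gives
    [(L - z S) w = f] ([pencil_onto]).  The representation [weak_solution] is
    obtained by minimising a quadratic functional over the domain of the
    operator; it also gives the existence of [K^*].

    It remains to see that [S] is such an operator.  As [K^*] maps [H] into
    [D(L)], the everywhere defined map [u |-> L K^* u] is a formal adjoint of [KL].  The
    closure of [KL] is therefore single valued, [I + closure(KL)] is symmetric
    by positivity, and, being onto, it is defined everywhere and equals
    [I + L K^*] ([surjective_symmetric_total]).  The theorem of Hellinger and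
    Toeplitz ([symmetric_bounded]) makes it bounded.  Coercivity follows from
    positivity and the bounded inverse, by the Cauchy-Schwarz inequality for the
    form [<Su,v>] ([coercive_of_bounded_inverse]). *)

(** * Real-valued norm and limits *)

Section RealNorm.
Variables (R : realType) (H : completeNormedModType R[i]).
Implicit Types (x y z : H) (t : R).

(** The norm of an [R[i]]-normed module takes its values in [R[i]], whose order
    is partial; estimates are made in [R]. *)
Definition rnorm x : R := complex.Re `|x|.

Lemma normE x : `|x| = (rnorm x)%:C.
Proof. by rewrite /rnorm RRe_real// normr_real. Qed.

Lemma rnorm_ge0 x : 0 <= rnorm x.
Proof. by rewrite -ler0c -normE. Qed.

Lemma rnormD x y : rnorm (x + y) <= rnorm x + rnorm y.
Proof. by rewrite -lecR raddfD/= -!normE ler_normD. Qed.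

Lemma rnormN x : rnorm (- x) = rnorm x.
Proof. by rewrite /rnorm normrN. Qed.

Lemma rnorm_distC x y : rnorm (x - y) = rnorm (y - x).
Proof. by rewrite -rnormN opprB. Qed.

Lemma rnormZ (a : R[i]) x : rnorm (a *: x) = complex.Re `|a| * rnorm x.
Proof.
by rewrite {1}/rnorm normrZ (normE x) normc_def/= !mul0r subr0.
Qed.

Lemma rnormZr t x : rnorm (t%:C *: x) = `|t| * rnorm x.
Proof. by rewrite rnormZ normc_def/= expr0n addr0 sqrtr_sqr. Qed.

Lemma rnorm0_eq0 x : rnorm x = 0 -> x = 0.
Proof. by move=> x0; apply/normr0_eq0; rewrite normE x0. Qed.

Lemma rnorm0 : rnorm 0 = 0.
Proof. by rewrite /rnorm normr0. Qed.

Lemma le_rnorm (C : R) x y :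
  (`|x| <= C%:C * `|y|) = (rnorm x <= C * rnorm y).
Proof. by rewrite !normE -rmorphM lecR. Qed.

Lemma rnorm_le_eq0 x : (forall e, 0 < e -> rnorm x <= e) -> x = 0.
Proof.
move=> xe; apply: rnorm0_eq0; apply/eqP; rewrite eq_le rnorm_ge0 andbT.
by apply/ler_addgt0Pr => e e0; rewrite add0r; exact: xe.
Qed.

(** Passing to the limit [m -> oo] in the Cauchy estimate keeps the rate, so the
    same [e_] controls the distance to the limit. *)
Lemma complete_limit (x_ : nat -> H) (e_ : nat -> R) :
  (forall n m, (n <= m)%N -> rnorm (x_ m - x_ n) <= e_ n) ->
  (forall d, 0 < d -> exists n, e_ n < d) ->
  exists l, forall n, rnorm (l - x_ n) <= e_ n.
Proof.
move=> xe e0.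
have /cauchy_cvgP xcvg : cauchy (x_ @ \oo).
  apply: cauchy_exP => d d0.
  have dE : (complex.Re d)%:C = d by rewrite RRe_real// gtr0_real.
  have /e0[n en] : 0 < complex.Re d by rewrite -ltcR dE.
  exists (x_ n); exists n => //= m /= nm.
  by rewrite -ball_normE/= normE -dE ltcR rnorm_distC (le_lt_trans (xe _ _ nm)).
exists (lim (x_ @ \oo)) => n; apply/ler_addgt0Pr => d d0.
have /cvgrPdist_le/(_ d%:C) := xcvg.
rewrite ltcR => /(_ d0)[m _ /(_ (maxn m n))] /=.
rewrite leq_maxl normE lecR => /(_ isT) h.
rewrite [e_ n + _]addrC; apply: le_trans (lerD h (xe n (maxn m n) (leq_maxr _ _))).
by rewrite (le_trans _ (rnormD _ _))// addrA subrK.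
Qed.

End RealNorm.

(** * Inner product *)

Section InnerProduct.
Variables (R : realType) (H : completeNormedModType R[i]).
Variable dot : {dot H for Num.conj}.
Hypothesis dot_norm : induces_norm dot.
Implicit Types (x y z u v w : H) (t : R).

Lemma dotC x y : dot y x = (dot x y)^*.
Proof. by rewrite hermC expr0 mul1r. Qed.

Lemma dotDl x y z : dot (x + y) z = dot x z + dot y z.
Proof. by rewrite linearDl. Qed.

Lemma dotDr x y z : dot x (y + z) = dot x y + dot x z.
Proof. by rewrite linearDr. Qed.

Lemma dotZl (a : R[i]) x y : dot (a *: x) y = a * dot x y.
Proof. by rewrite linearZl_LR. Qed.

Lemma dotZr (a : R[i]) x y : dot x (a *: y) = a^* * dot x y.
Proof. by rewrite linearZr_LR. Qed.

Lemma dotNl x y : dot (- x) y = - dot x y.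
Proof. by rewrite linearNl. Qed.

Lemma dotNr x y : dot x (- y) = - dot x y.
Proof. by rewrite linearNr. Qed.

(** The underlying real inner product; the complex one is recovered from it
    through multiplication by [i]. *)
Definition rdot x y : R := complex.Re (dot x y).

Lemma rdotC x y : rdot x y = rdot y x.
Proof. by rewrite /rdot dotC; case: (dot y x). Qed.

Lemma rdotDl x y z : rdot (x + y) z = rdot x z + rdot y z.
Proof. by rewrite /rdot dotDl raddfD. Qed.

Lemma rdotDr x y z : rdot x (y + z) = rdot x y + rdot x z.
Proof. by rewrite !(rdotC x) rdotDl. Qed.

Lemma rdotZl t x y : rdot (t%:C *: x) y = t * rdot x y.
Proof. by rewrite /rdot dotZl; case: (dot x y) => a b /=; rewrite mul0r subr0. Qed.

Lemma rdotZr t x y : rdot x (t%:C *: y) = t * rdot x y.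
Proof. by rewrite !(rdotC x) rdotZl. Qed.

Lemma rdotNl x y : rdot (- x) y = - rdot x y.
Proof. by rewrite /rdot linearNl raddfN. Qed.

Lemma rdotNr x y : rdot x (- y) = - rdot x y.
Proof. by rewrite !(rdotC x) rdotNl. Qed.

Lemma rdotxx x : rdot x x = rnorm x ^+ 2.
Proof. by rewrite /rdot -dot_norm normE expr2/= mul0r subr0. Qed.

Lemma Im_dot x y : complex.Im (dot x y) = - rdot ('i *: x) y.
Proof. by rewrite /rdot dotZl; case: (dot x y) => a b /=; ring. Qed.

Lemma dot_ext (a b : R[i]) : complex.Re a = complex.Re b ->
  complex.Re ('i * a) = complex.Re ('i * b) -> a = b.
Proof.
case: a b => [a1 a2] [b1 b2] /= -> h; congr (_ +i* _); lra.
Qed.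

(** A quadratic polynomial that is nonnegative on the whole line has a
    nonpositive discriminant. *)
Lemma quadratic_discr (a b c : R) : 0 <= c ->
  (forall t, 0 <= a + 2 * t * b + t ^+ 2 * c) -> b ^+ 2 <= a * c.
Proof.
rewrite le_eqVlt => /orP[/eqP<- h|c0 h].
  have [->|b0] := eqVneq b 0; first by rewrite expr0n mulr0.
  (* When c = 0 and b != 0, the affine function takes the value -1. *)
  have := h (- (a + 1) / (2 * b)).
  have -> : a + 2 * (- (a + 1) / (2 * b)) * b +
            (- (a + 1) / (2 * b)) ^+ 2 * 0 = - 1 by field.
  by rewrite ler0N1.
have := h (- b / c).
have -> : a + 2 * (- b / c) * b + (- b / c) ^+ 2 * c = (a * c - b ^+ 2) / c.
  by field; rewrite gt_eqF.
by rewrite pmulr_lge0 ?invr_gt0// subr_ge0.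
Qed.

(** Applied both to the inner product, with the identity for [S], and to the
    form attached to [I + KL]. *)
Lemma form_CauchySchwarz (S : H -> H) :
  (forall t u v, S (t%:C *: u + v) = t%:C *: S u + S v) ->
  (forall u v, rdot (S u) v = rdot u (S v)) ->
  (forall u, 0 <= rdot (S u) u) ->
  forall u v, rdot (S u) v ^+ 2 <= rdot (S u) u * rdot (S v) v.
Proof.
move=> Sl Ss Sp u v; apply: quadratic_discr => // t.
have := Sp (t%:C *: v + u).
rewrite Sl !(rdotDl, rdotDr, rdotZl, rdotZr) (Ss v u) (rdotC v).
by congr (0 <= _); ring.
Qed.

Lemma rdot_le x y : `|rdot x y| <= rnorm x * rnorm y.
Proof.
have xy0 : 0 <= rnorm x * rnorm y by rewrite mulr_ge0 ?rnorm_ge0.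
rewrite -(ger0_norm xy0) -ler_sqr ?nnegrE// !real_normK ?num_real//.
rewrite exprMn -!rdotxx; apply: (@form_CauchySchwarz id) => // u.
by rewrite rdotxx exprn_ge0 ?rnorm_ge0.
Qed.

Lemma rdot_le1 x y : rdot x y <= rnorm x * rnorm y.
Proof. exact: le_trans (ler_norm _) (rdot_le x y). Qed.

Lemma rdot_eq0 x : (forall y, rdot y x = 0) -> x = 0.
Proof.
move=> /(_ x); rewrite rdotxx => /eqP; rewrite sqrf_eq0 => /eqP.
exact: rnorm0_eq0.
Qed.

Lemma dot_inj x y : (forall z, dot z x = dot z y) -> x = y.
Proof.
move=> xy; apply/subr0_eq/rdot_eq0 => z.
by rewrite rdotDr rdotNr /rdot xy subrr.
Qed.

(** * Linear operators and weak solutions *)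

Section LinearOp.
Variable A : op H.
Hypothesis lA : linear_op A.

Lemma linear_op_dom0 : dom A 0. Proof. by case: lA. Qed.

Lemma linear_op0 : A 0 = 0.
Proof.
have [d0 _ /(_ 1 0 0 d0 d0)] := lA.
by rewrite !scale1r addr0 => /eqP; rewrite -subr_eq0 opprD addrA subrr sub0r
  oppr_eq0 => /eqP.
Qed.

Lemma linear_op_domP a u v : dom A u -> dom A v -> dom A (a *: u + v).
Proof. by case: lA => _ + _; exact. Qed.

Lemma linear_opP a u v : dom A u -> dom A v -> A (a *: u + v) = a *: A u + A v.
Proof. by case: lA => _ _; exact. Qed.

Lemma linear_op_domD u v : dom A u -> dom A v -> dom A (u + v).
Proof. by move=> du dv; rewrite -[u]scale1r; exact: linear_op_domP. Qed.

Lemma linear_opD u v : dom A u -> dom A v -> A (u + v) = A u + A v.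
Proof.
by move=> du dv; rewrite -[u in LHS]scale1r linear_opP// scale1r.
Qed.

Lemma linear_op_domZ a u : dom A u -> dom A (a *: u).
Proof.
by move=> du; rewrite -[_ *: _]addr0; apply: linear_op_domP linear_op_dom0.
Qed.

Lemma linear_opZ a u : dom A u -> A (a *: u) = a *: A u.
Proof.
move=> du; rewrite -[_ *: _ in LHS]addr0 (linear_opP _ du linear_op_dom0).
by rewrite linear_op0 addr0.
Qed.

Lemma linear_op_domB u v : dom A u -> dom A v -> dom A (u - v).
Proof.
by move=> du dv; rewrite addrC -scaleN1r; exact: linear_op_domP.
Qed.

Lemma linear_opB u v : dom A u -> dom A v -> A (u - v) = A u - A v.
Proof.
by move=> du dv; rewrite addrC -scaleN1r linear_opP// scaleN1r addrC.
Qed.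

End LinearOp.

(** Every functional controlled by [|A u|] is represented through [A]: the real
    functional [J u = |A u|^2 - 2 Re (phi u)] is bounded below, the
    parallelogram identity makes the images [A (u_ n)] of a minimising sequence
    Cauchy, and the stationarity of [J] identifies their limit [w].  The
    identity operator gives the representation theorem of Riesz. *)
Lemma weak_solution (A : op H) (phi : H -> R[i]) (C : R) :
  linear_op A ->
  (forall a u v, dom A u -> dom A v -> phi (a *: u + v) = a * phi u + phi v) ->
  (forall u, dom A u -> complex.Re (phi u) <= C * rnorm (A u)) ->
  exists w, forall u, dom A u -> phi u = dot (A u) w.
Proof.
move=> lA phiP phile.
pose psi u := complex.Re (phi u).
have d0 := linear_op_dom0 lA.
have phi0 : phi 0 = 0.
  have := phiP 1 0 0 d0 d0; rewrite scale1r mul1r addr0 => h.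
  by apply: (addIr (phi 0)); rewrite -h add0r.
have psiP t u v : dom A u -> dom A v -> psi (t%:C *: u + v) = t * psi u + psi v.
  by move=> du dv; rewrite /psi phiP// raddfD/=; case: (phi u) => a b /=; ring.
pose J u := rnorm (A u) ^+ 2 - 2 * psi u.
have Jlb u : dom A u -> - C ^+ 2 <= J u.
  move=> /phile; rewrite -/(psi u) => h.
  have := sqr_ge0 (rnorm (A u) - C); rewrite /J; nra.
have Jinf : has_inf (J @` dom A).
  split; first by exists (J 0); exists 0.
  by exists (- C ^+ 2) => _ [u du <-]; exact: Jlb.
pose m := inf (J @` dom A).
have mJ u : dom A u -> m <= J u.
  by move=> du; apply: ge_inf; [case: Jinf|exists u].
(* The tolerance (1 / (2 (n + 1)))^2 on J bounds the distance of A (u_ n) to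
   the next terms by 1 / (n + 1). *)
have exu n : exists u, dom A u /\ J u <= m + (n.+1%:R^-1 / 2) ^+ 2.
  have e0 : 0 < (n.+1%:R^-1 / 2 : R) ^+ 2 by rewrite exprn_gt0.
  have [_ [u du <-] /ltW Ju] := inf_adherent e0 Jinf.
  by exists u.
have [u_ u_P] := choice exu.
have du n : dom A (u_ n) by case: (u_P n).
have Ju n : J (u_ n) <= m + (n.+1%:R^-1 / 2) ^+ 2 by case: (u_P n).
have [w wP] : exists w, forall n, rnorm (w - A (u_ n)) <= n.+1%:R^-1.
  apply: complete_limit => [n k nk|d d0'].
    have e0 : 0 <= (n.+1%:R^-1 : R) by rewrite invr_ge0.
    have ek : (k.+1%:R^-1 : R) <= n.+1%:R^-1.
      by rewrite lef_pV2 ?posrE// ler_nat.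
    rewrite -ler_sqr ?nnegrE ?rnorm_ge0//.
    have dh : dom A ((2^-1)%:C *: (u_ k + u_ n) + 0).
      by apply: linear_op_domP => //; exact: linear_op_domD.
    (* Compare with the value of J at the midpoint of u_ n and u_ k. *)
    have := mJ _ dh; rewrite /J psiP ?linear_opP//; last 2 first.
    - exact: linear_op_domD.
    - exact: linear_op_domD.
    have -> : psi (u_ k + u_ n) = psi (u_ k) + psi (u_ n).
      by have := psiP 1 _ _ (du k) (du n); rewrite scale1r mul1r.
    rewrite /psi phi0 -/(psi _) -/(psi _) linear_opD// linear_op0// !addr0 rnormZr.
    have := Ju k; have := Ju n; rewrite /J -!rdotxx.
    rewrite !exprMn -!rdotxx !(rdotDl, rdotDr, rdotNl, rdotNr).
    rewrite (rdotC (A (u_ n))) ger0_norm ?invr_ge0//.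
    have : (k.+1%:R^-1 : R) ^+ 2 <= n.+1%:R^-1 ^+ 2.
      by rewrite ler_sqr ?nnegrE ?invr_ge0.
    have -> : (2^-1 : R) ^+ 2 = 4^-1 by field.
    move: (n.+1%:R^-1 ^+ 2) (k.+1%:R^-1 ^+ 2) (rdot _ _) (rdot _ _) (rdot _ _)
      (psi _) (psi _) => p q r1 r2 r3 p1 p2.
    lra.
  have /ltr_add_invr[k] : (0 : R) < d by [].
  by rewrite add0r => kd; exists k.
(* It suffices to represent the real part: evaluating at 'i *: u then gives the
   imaginary part. *)
suff psiE v : dom A v -> psi v = rdot (A v) w.
  exists w => u dAu; apply: dot_ext; first exact: psiE.
  have := psiE _ (linear_op_domZ lA 'i dAu).
  rewrite /psi -[X in phi X]addr0 phiP// phi0 addr0 => ->.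
  by rewrite linear_opZ// /rdot dotZl.
move=> dv.
have key n : `|rdot (A v) w - psi v| <= n.+1%:R^-1 * (2 * rnorm (A v)).
  have e0 : 0 <= (n.+1%:R^-1 : R) by rewrite invr_ge0.
  have Av0 := rnorm_ge0 (A v).
  have -> : rdot (A v) w - psi v =
      rdot (A v) (w - A (u_ n)) + (rdot (A v) (A (u_ n)) - psi v).
    by rewrite rdotDr rdotNr; ring.
  rewrite (le_trans (ler_normD _ _))//.
  have -> : n.+1%:R^-1 * (2 * rnorm (A v)) =
    rnorm (A v) * n.+1%:R^-1 + rnorm (A v) * n.+1%:R^-1 :> R by ring.
  apply: lerD; first by rewrite (le_trans (rdot_le _ _))// ler_wpM2l.
  rewrite -ler_sqr ?nnegrE ?mulr_ge0// real_normK ?num_real//.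
  apply: (@le_trans _ _ ((n.+1%:R^-1 / 2) ^+ 2 * rnorm (A v) ^+ 2)); last first.
    rewrite [leRHS]exprMn [leRHS]mulrC ler_wpM2r ?exprn_ge0//.
    rewrite ler_sqr ?nnegrE ?divr_ge0//.
    by rewrite ler_pdivrMr// ler_peMr// ler1n.
  (* Near-minimality of u_ n on the real line through u_ n in the direction v
     bounds the derivative of J there. *)
  apply: quadratic_discr; first by rewrite exprn_ge0.
  move=> t; have := mJ _ (linear_op_domP lA t%:C dv (du n)); have := Ju n.
  rewrite /J psiP// linear_opP// -!rdotxx !(rdotDl, rdotDr, rdotZl, rdotZr).
  rewrite (rdotC (A (u_ n)) (A v)).
  move: ((_ / 2) ^+ 2) (rdot _ _) (rdot _ _) (rdot _ _) (psi _) (psi _).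
  move=> p r1 r2 r3 p1 p2; nra.
apply/esym/subr0_eq/eqP; rewrite -normr_le0; apply/ler_addgt0Pr => d d0'.
rewrite add0r.
have Av1 : 0 < 2 * rnorm (A v) + 1 by rewrite ltr_wpDl// mulr_ge0// rnorm_ge0.
have /ltr_add_invr[k] : 0 < d / (2 * rnorm (A v) + 1) by rewrite divr_gt0.
rewrite add0r => /ltW; rewrite ler_pdivlMr// => kd.
apply: le_trans (key k) (le_trans _ kd).
by rewrite ler_wpM2l ?invr_ge0// lerDl.
Qed.

End InnerProduct.

(** * Everywhere defined symmetric operators *)

(** The limit is within [(4/3) 4^-(n+1) = (1/3) 4^-n] of [x_ n.+1]: with the
    ratio 4, the steps that follow the [n]-th one add up to less than half of
    the bound on that step. *)
Lemma geometric_limit (R : realType) (H : completeNormedModType R[i])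
    (x_ : nat -> H) :
  (forall n, rnorm (x_ n.+1 - x_ n) <= 4^-1 ^+ n) ->
  exists l, forall n, rnorm (l - x_ n) <= 4 / 3 * 4^-1 ^+ n.
Proof.
move=> xS; apply: complete_limit => [n m nm|d d0].
  have q0 k : 0 <= (4^-1 : R) ^+ k by rewrite exprn_ge0.
  rewrite -(subnK nm) addnC; move: (m - n)%N => k.
  suff : rnorm (x_ (n + k)%N - x_ n) <=
         4 / 3 * (4^-1 ^+ n - 4^-1 ^+ (n + k)).
    by move/le_trans; apply; rewrite ler_wpM2l// gerBl.
  elim: k => [|k IH]; first by rewrite addn0 !subrr mulr0 rnorm0.
  rewrite addnS -(subrKA (x_ (n + k)%N)).
  apply: (le_trans (rnormD _ _)); rewrite exprS.
  apply: le_trans (lerD (xS _) IH) _.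
  by move: (4^-1 ^+ n) (4^-1 ^+ (n + k)) => p r; lra.
have /ltr_add_invr[n] : 0 < d / 2 by rewrite divr_gt0.
rewrite add0r => nd; exists n.
have : (4^-1 : R) ^+ n <= n.+1%:R^-1.
  rewrite exprVn lef_pV2 ?posrE ?exprn_gt0// -natrX ler_nat.
  exact: ltn_expl.
move: nd; move: (4^-1 ^+ n) (n.+1%:R^-1) => p r.
lra.
Qed.

Section SymmetricOperators.
Variables (R : realType) (H : completeNormedModType R[i]).
Variable dot : {dot H for Num.conj}.
Hypothesis dot_norm : induces_norm dot.
Local Notation rdot := (rdot dot).
Implicit Types (A : op H) (S T : H -> H) (u v w : H).

(** Hellinger-Toeplitz, by a gliding hump.  If [S] is unbounded, choose [y_ n]
    with [|S (y_ n)|] much larger than [4^n n |y_ n|], and build [x] by steps of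
    size at most [4^-n], the [n]-th one making [<x, S (y_ n)>] large.  The later
    steps are too small to undo this, so
    [|S x| |y_ n| >= |<x, S (y_ n)>| > n |y_ n|] for every [n]. *)
Lemma symmetric_bounded S : (forall u v, rdot (S u) v = rdot u (S v)) ->
  exists C, forall u, rnorm (S u) <= C * rnorm u.
Proof.
move=> Ssym; apply: contrapT => nb.
pose q : R := 4^-1.
have q0 n : 0 < q ^+ n by rewrite exprn_gt0// invr_gt0.
have exy n : exists y, 6 * n%:R / q ^+ n * rnorm y < rnorm (S y).
  apply: contrapT => h; apply: nb; exists (6 * n%:R / q ^+ n) => y.
  by rewrite leNgt; apply/negP => hy; apply: h; exists y.
have [y_ yP] := choice exy.
have Sy0 n : 0 < rnorm (S (y_ n)).
  apply: le_lt_trans (yP n); rewrite mulr_ge0 ?rnorm_ge0//.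
  by rewrite divr_ge0 ?mulr_ge0// ltW.
(* g n is S (y_ n) rescaled to the norm q ^+ n. *)
pose g n := (q ^+ n / rnorm (S (y_ n)))%:C *: S (y_ n).
have gn n : rnorm (g n) = q ^+ n.
  rewrite rnormZr ger0_norm; last by rewrite divr_ge0// ltW.
  by rewrite divfK// gt_eqF.
have gS n : rdot (g n) (S (y_ n)) = q ^+ n * rnorm (S (y_ n)).
  by rewrite rdotZl rdotxx//; field; exact: lt0r_neq0 (Sy0 n).
pose big n x := q ^+ n * rnorm (S (y_ n)) / 2 <= `|rdot x (S (y_ n))|.
pose step n x := if big n x then x else x + g n.
(* <x, S (y_ n)> and <x + g n, S (y_ n)> differ by q ^+ n * |S (y_ n)|, so one
   of them is at least half of that in modulus. *)
have step_big n x : big n (step n x).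
  rewrite /step; case: ifPn => //; rewrite /big -ltNge rdotDl gS => h.
  rewrite addrC; apply: le_trans (lerB_normD _ _).
  by rewrite ger0_norm; [lra|rewrite mulr_ge0 ?rnorm_ge0// ltW].
pose x_ n := iteri n step 0.
have [x xP] : exists l, forall n, rnorm (l - x_ n) <= 4 / 3 * 4^-1 ^+ n.
  apply: geometric_limit => n; rewrite /x_ iteriS -/(x_ n) /step.
  by case: ifP => _; rewrite ?subrr ?rnorm0 1?addrC ?addKr ?gn// ltW.
(* From the bound 1/2 on the hump, the later steps take away at most 1/3. *)
have main n : n%:R < rnorm (S x).
  have y0 := rnorm_ge0 (y_ n).
  have h1 : q ^+ n * rnorm (S (y_ n)) / 6 <= `|rdot x (S (y_ n))|.
    have -> : x = x_ n.+1 + (x - x_ n.+1) by rewrite addrC subrK.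
    rewrite rdotDl; apply: le_trans (lerB_normD _ _).
    have := step_big n (x_ n); rewrite /big -iteriS -/(x_ n.+1).
    have := rdot_le dot_norm (x - x_ n.+1) (S (y_ n)).
    have := ler_wpM2r (ltW (Sy0 n)) (xP n.+1).
    have -> : 4 / 3 * 4^-1 ^+ n.+1 = q ^+ n / 3 by rewrite exprS -/q /q; field.
    by rewrite mulrAC; move: (q ^+ n * _) (_ * rnorm (S _)) `|_| `|_| => a b c e; lra.
  have h2 : `|rdot x (S (y_ n))| <= rnorm (S x) * rnorm (y_ n).
    by rewrite -Ssym rdot_le.
  have h3 : n%:R * rnorm (y_ n) < q ^+ n * rnorm (S (y_ n)) / 6.
    have := yP n; rewrite -(ltr_pM2l (q0 n)) => h.
    rewrite ltr_pdivlMr//; apply: le_lt_trans h.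
    by rewrite le_eqVlt; apply/orP; left; apply/eqP; field; rewrite gt_eqF.
  have := lt_le_trans h3 (le_trans h1 h2); move: y0.
  rewrite le_eqVlt => /orP[/eqP<-|y0]; first by rewrite !mulr0 ltxx.
  by rewrite ltr_pM2r.
have := truncnS_gt (rnorm (S x)); rewrite ltNge => /negP; apply.
by rewrite ltW.
Qed.

Lemma symmetric_linear S : (forall u v, dot (S u) v = dot u (S v)) ->
  forall (a : R[i]) u v, S (a *: u + v) = a *: S u + S v.
Proof.
move=> Ss a u v; apply: (dot_inj dot_norm) => z.
by rewrite -Ss !(dotDr, dotZr) !Ss.
Qed.

(** With [S p = u], Cauchy-Schwarz for the form [<Sx,y>] gives
    [|u|^4 = <Su,p>^2 <= <Su,u> <Sp,p>], and [<Sp,p> = <u,p> <= C |u|^2]. *)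
Lemma coercive_of_bounded_inverse S C :
  (forall u v, dot (S u) v = dot u (S v)) ->
  (forall u, 0 <= dot (S u) u) -> (forall f, exists u, S u = f) ->
  (forall u, rnorm u <= C * rnorm (S u)) ->
  exists2 c, 0 < c & forall u, c * rnorm u ^+ 2 <= rdot (S u) u.
Proof.
move=> Ss Sp Sf SC; have rS u v : rdot (S u) v = rdot u (S v) by rewrite /rdot Ss.
have Spr u : 0 <= rdot (S u) u by have := Sp u; rewrite lecE => /andP[].
have C1 : 0 < `|C| + 1 by rewrite ltr_wpDl.
exists (`|C| + 1)^-1; first by rewrite invr_gt0.
move=> u; rewrite mulrC ler_pdivrMr//.
have [p pu] := Sf u.
have Sl t x y : S (t%:C *: x + y) = t%:C *: S x + S y by exact: symmetric_linear.
have := form_CauchySchwarz Sl rS Spr u p.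
rewrite rS pu rdotxx//.
have up : rdot u p <= (`|C| + 1) * rnorm u ^+ 2.
  apply: le_trans (rdot_le1 dot_norm _ _) _.
  rewrite expr2 mulrA mulrC ler_wpM2r ?rnorm_ge0//.
  have := SC p; rewrite pu => /le_trans; apply.
  rewrite ler_wpM2r ?rnorm_ge0// (le_trans (ler_norm _))//.
  by rewrite lerDl.
have := rnorm_ge0 u; rewrite le_eqVlt => /orP[/eqP<-|u0].
  by rewrite expr0n/= => _; rewrite mulr_ge0// ltW.
have u20 : 0 < rnorm u ^+ 2 by rewrite exprn_gt0.
move=> h; rewrite -(ler_pM2r u20) -expr2 (le_trans h)//.
by rewrite -mulrA ler_wpM2l.
Qed.

(** A bounded operator has an everywhere defined adjoint: [u |-> <Ku,v>] is a
    bounded functional, hence represented by a vector. *)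
Lemma adjoint_total (K : {linear H -> H}) : bounded_op (op_total K) ->
  forall v, dom (op_adj dot (op_total K)) v /\
    forall u, dot (K u) v = dot u (op_adj dot (op_total K) v).
Proof.
move=> [C KC] v.
have [w wP] : exists w, forall u, setT u -> dot (K u) v = dot u w.
  apply: (@weak_solution _ _ _ dot_norm (op_total idfun) (fun u => dot (K u) v)
    (C * rnorm v)) => [|a x y _ _|x _].
  - by split.
  - by rewrite linearP dotDl dotZl.
  - apply: le_trans (rdot_le1 dot_norm _ _) _.
    rewrite [leRHS]mulrAC ler_wpM2r ?rnorm_ge0//.
    by rewrite -le_rnorm; exact: KC.
have ex : exists w, forall u, dom (op_total K) u -> dot (K u) v = dot u w.
  by exists w.
split; first exact: ex.
by move=> u; exact: (getPex ex u Logic.I).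
Qed.

(** * Closure of an operator *)

(** The relation [<v,w> = <u,w'>] is closed in [(u,v)]. *)
Lemma closure_adjoint A w w' :
  (forall u, dom A u -> dot (A u) w = dot u w') ->
  forall u v, closure (graph A) (u, v) -> dot v w = dot u w'.
Proof.
move=> Aw u v cuv.
suff re x x' : (forall u, dom A u -> rdot (A u) x = rdot u x') ->
    rdot v x = rdot u x'.
  apply: dot_ext; first by apply: re => y /Aw; rewrite /rdot => ->.
  have iZ y z : 'i * dot y z = dot y ('i^* *: z) by rewrite dotZr conjCK.
  rewrite !iZ; apply: re => y /Aw.
  by rewrite /rdot !dotZr => ->.
move=> Ax; apply/subr0_eq/eqP; rewrite -normr_le0; apply/ler_addgt0Pr => d d0.
rewrite add0r; pose e := d / (rnorm x + rnorm x' + 1).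
have n0 : 0 < rnorm x + rnorm x' + 1 by rewrite ltr_wpDl// addr_ge0 ?rnorm_ge0.
have e0 : 0 < e by rewrite divr_gt0.
have [] := cuv (ball u e%:C `*` ball v e%:C).
  by exists (ball u e%:C, ball v e%:C) => //=; split; apply: nbhsx_ballx; rewrite ltcR.
move=> [y y'] [[/= dy <-]] []; rewrite -!ball_normE /= !normE !ltcR => uy vy.
have -> : rdot v x - rdot u x' = rdot (v - A y) x - rdot (u - y) x'.
  by rewrite !rdotDl !rdotNl Ax//; ring.
apply: le_trans (ler_normB _ _) _.
apply: (@le_trans _ _ (e * rnorm x + e * rnorm x')).
  by apply: lerD; (apply: le_trans (rdot_le dot_norm _ _) _;
    rewrite ler_wpM2r ?rnorm_ge0// ltW).
have -> : d = e * (rnorm x + rnorm x' + 1) by rewrite divfK// gt_eqF.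
by rewrite -mulrDr; apply: ler_wpM2l (ltW e0) _ _ _; rewrite lerDl.
Qed.

Lemma op_closureP A u : dom (op_closure A) u ->
  closure (graph A) (u, op_closure A u).
Proof. exact: getPex. Qed.

Lemma op_closure_adjoint A T :
  (forall u w, dom A u -> dot (A u) w = dot u (T w)) ->
  forall u w, dom (op_closure A) u -> dot (op_closure A u) w = dot u (T w).
Proof.
by move=> AT u w /op_closureP; apply: closure_adjoint => x; exact: AT.
Qed.

(** An everywhere defined formal adjoint separates the values, so the closure of
    the graph is the graph of a function. *)
Lemma op_closure_restriction A T :
  (forall u w, dom A u -> dot (A u) w = dot u (T w)) ->
  restriction A (op_closure A).
Proof.
move=> AT; suff h u : dom A u -> dom (op_closure A) u /\ A u = op_closure A u.
  by split => u /h[].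
move=> du; have cu : closure (graph A) (u, A u) by exact: subset_closure.
have dcu : dom (op_closure A) u by exists (A u).
split=> //; apply: (dot_inj dot_norm) => z; rewrite !(dotC _ _ z).
by rewrite (op_closure_adjoint AT)// AT.
Qed.

Lemma op_closure_symmetric A :
  (forall u v, dom A u -> dom A v -> dot (A u) v = dot u (A v)) ->
  forall u v, dom (op_closure A) u -> dom (op_closure A) v ->
    dot (op_closure A u) v = dot u (op_closure A v).
Proof.
move=> As u v /op_closureP cu /op_closureP cv.
apply: closure_adjoint cu => x dx; rewrite (dotC _ v) (dotC _ _ x).
by congr (_^*); apply/esym; apply: closure_adjoint cv => y dy; exact: As.
Qed.

(** Polarisation: the reality of the form at [u + v] and at [i v + u] determines
    both parts of [<Au,v> - <u,Av>]. *)
Lemma real_form_symmetric A : linear_op A ->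
  (forall u, dom A u -> complex.Im (dot (A u) u) = 0) ->
  forall u v, dom A u -> dom A v -> dot (A u) v = dot u (A v).
Proof.
move=> lA Ar u v du dv.
have := Ar _ (linear_op_domD lA du dv).
have := Ar _ (linear_op_domP lA 'i dv du).
rewrite linear_opP// linear_opD// !(dotDl, dotDr, dotZl, dotZr) (dotC _ (A v) u).
have := Ar _ du; have := Ar _ dv.
case: (dot (A u) u) (dot (A v) v) (dot (A u) v) (dot (A v) u) =>
  [a1 a2] [b1 b2] [c1 c2] [d1 d2] /= -> -> h1 h2.
by congr (_ +i* _); lra.
Qed.

(** Given [x], choose [y] in the domain with [A y = T x].  Then
    [<Au,x> = <u,Tx> = <u,Ay> = <Au,y>] for all [u] in the domain, and [x = y]
    because [A] is onto. *)
Lemma surjective_symmetric_total A T :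
  (forall u w, dom A u -> dot (A u) w = dot u (T w)) ->
  (forall u v, dom A u -> dom A v -> dot (A u) v = dot u (A v)) ->
  op_range A = setT -> forall u, dom A u /\ A u = T u.
Proof.
move=> AT As Af x.
have [y dy yx] : op_range A (T x) by rewrite Af.
have xy : x = y.
  apply: (dot_inj dot_norm) => z.
  have [u du <-] : op_range A z by rewrite Af.
  by rewrite AT// -yx As.
by rewrite {1 2}xy.
Qed.

End SymmetricOperators.

(** * The pencil of a self-adjoint and a coercive operator *)

Section SelfAdjointPencil.
Variables (R : realType) (H : completeNormedModType R[i]).
Variable dot : {dot H for Num.conj}.
Hypothesis dot_norm : induces_norm dot.
Local Notation rdot := (rdot dot).
Implicit Types (A L : op H) (S : H -> H) (u v w : H).

Lemma dense_orthogonal (D : set H) x :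
  dense D -> (forall u, D u -> dot u x = 0) -> x = 0.
Proof.
move=> dD Dx; apply: rnorm_le_eq0 => e e0.
have e0' : 0 < e%:C by rewrite ltcR.
have [u [xu du]] : ball x e%:C `&` D !=set0.
  by apply: dD; [exists x; exact: ballxx|exact: ball_open].
move: xu; rewrite -ball_normE /= normE ltcR => xu.
have := rnorm_ge0 x; rewrite le_eqVlt => /orP[/eqP<-|x0]; first exact: ltW.
rewrite -(ler_pM2r x0) -expr2 -(rdotxx dot_norm).
have ux : rdot u x = 0 by rewrite /rdot Dx.
have -> : rdot x x = rdot (x - u) x by rewrite rdotDl rdotNl ux subr0.
by apply: le_trans (rdot_le1 dot_norm _ _) _; rewrite ler_wpM2r ?rnorm_ge0// ltW.
Qed.

Lemma op_eqP A B : op_eq A B -> forall u, dom A u -> dom B u /\ B u = A u.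
Proof.
move=> AB u du; have : graph A (u, A u) by [].
by rewrite AB => -[].
Qed.

Lemma self_adjoint_symmetric L : self_adjoint dot L ->
  forall u v, dom L u -> dom L v -> dot (L u) v = dot u (L v).
Proof.
move=> [_ /op_eqP LE] u v du /LE[dv <-].
exact: (getPex dv).
Qed.

Lemma self_adjoint_maximal L : self_adjoint dot L ->
  forall v w, (forall u, dom L u -> dot (L u) v = dot u w) ->
  dom L v /\ L v = w.
Proof.
move=> [dL LE] v w vw; have dv : dom (op_adj dot L) v by exists w.
have [dLv Lv] := op_eqP (esym LE) dv; split=> //; rewrite Lv.
apply/subr0_eq/(dense_orthogonal dL) => u du.
by rewrite dotDr dotNr -vw// -(getPex dv)// subrr.
Qed.

Section Pencil.
Variables (L : op H) (S : H -> H) (c : R).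
Hypotheses (lL : linear_op L) (saL : self_adjoint dot L).
Hypothesis S_sym : forall u v, dot (S u) v = dot u (S v).
Hypotheses (c_gt0 : 0 < c)
  (S_coercive : forall u, c * rnorm u ^+ 2 <= rdot (S u) u).

(** Only [z S] contributes to the imaginary part of [<Lu - z Su, u>]. *)
Lemma pencil_bounded_below (z : R[i]) u : complex.Im z != 0 -> dom L u ->
  rnorm u <= (c * `|complex.Im z|)^-1 * rnorm (L u - z *: S u).
Proof.
move=> z0 du; set f := L u - _.
have n0 : 0 < `|complex.Im z| by rewrite normr_gt0.
have real_of (a : R[i]) : a = a^*%C -> complex.Im a = 0.
  by case: a => a1 a2 [] h /=; lra.
have Lr : complex.Im (dot (L u) u) = 0.
  by apply: real_of; rewrite -dotC self_adjoint_symmetric.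
have Sr : complex.Im (dot (S u) u) = 0 by apply: real_of; rewrite -dotC S_sym.
have fE : complex.Im (dot f u) = - (complex.Im z * rdot (S u) u).
  rewrite /f dotDl dotNl dotZl /rdot; move: Lr Sr.
  case: (dot (L u) u) (dot (S u) u) z {f z0 n0} => [a1 a2] [b1 b2] [z1 z2] /= -> ->.
  by ring.
have h : `|complex.Im z| * (c * rnorm u ^+ 2) <= rnorm f * rnorm u.
  apply: (@le_trans _ _ `|complex.Im (dot f u)|).
    rewrite fE normrN normrM ler_wpM2l// (le_trans (S_coercive u))// ler_norm//.
  rewrite Im_dot normrN (le_trans (rdot_le dot_norm _ _))//.
  by rewrite rnormZ normc_def/= expr0n expr1n add0r sqrtr1 mul1r.
rewrite mulrC ler_pdivlMr ?mulr_gt0//.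
have := rnorm_ge0 u; rewrite le_eqVlt => /orP[/eqP<-|u0].
  by rewrite mul0r rnorm_ge0.
by rewrite -(ler_pM2r u0) (le_trans _ h)// le_eqVlt; apply/orP; left; apply/eqP; ring.
Qed.

(** Since [L - z S] is the adjoint of [L - z^* S], a weak solution for the latter
    is a solution for the former, and the lower bound at [z^*] provides it. *)
Lemma pencil_onto (z : R[i]) f : complex.Im z != 0 ->
  exists2 u, dom L u & L u - z *: S u = f.
Proof.
move=> z0; pose A := Op (dom L) (fun u => L u - z^* *: S u).
have Sl := symmetric_linear dot_norm S_sym.
have lA : linear_op A.
  split=> [|a u v|a u v du dv] /=; first exact: linear_op_dom0.
    exact: linear_op_domP.
  rewrite linear_opP// Sl !scalerDr scalerN !scalerA mulrC opprD.
  by rewrite addrACA.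
have zJ : complex.Im (z^*) != 0 by case: z z0 {A lA} => z1 z2 /=; rewrite oppr_eq0.
have [||w wP] := @weak_solution _ _ _ dot_norm A (fun u => dot u f)
    ((c * `|complex.Im z^*|)^-1 * rnorm f) lA.
- by move=> a u v _ _; rewrite dotDl dotZl.
- move=> u du; apply: le_trans (rdot_le1 dot_norm _ _) _.
  rewrite [leRHS]mulrAC ler_wpM2r ?rnorm_ge0//.
  exact: pencil_bounded_below.
have [dw Lw] : dom L w /\ L w = f + z *: S w.
  apply: (self_adjoint_maximal saL) => u du.
  rewrite dotDr wP//= dotDl dotNl dotZl dotZr S_sym.
  by rewrite subrK.
by exists w => //; rewrite Lw addrK.
Qed.

End Pencil.
End SelfAdjointPencil.

(** * Reality of the spectrum *)

Lemma op_inv_id (H : pointedType) (A : op H) u :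
  set_inj (dom A) A -> dom A u -> op_inv A (A u) = u.
Proof.
move=> Ai du; have ex : exists v, dom A v /\ A v = A u by exists u.
by have [dv Av] := getPex ex; apply: Ai; rewrite ?inE.
Qed.

Lemma op_invP (H : pointedType) (A : op H) f :
  op_range A = setT -> dom A (op_inv A f) /\ A (op_inv A f) = f.
Proof.
move=> Af; have [u du uf] : op_range A f by rewrite Af.
by apply: (@getPex _ [set u | dom A u /\ A u = f]); exists u.
Qed.

Lemma correctly_solvable_inj (R : realType) (H : completeNormedModType R[i])
    (A : op H) : linear_op A -> correctly_solvable A -> set_inj (dom A) A.
Proof.
move=> lA [C _ AC] u v /set_mem du /set_mem dv uv; apply/subr0_eq/rnorm0_eq0.
have := AC _ (linear_op_domB lA du dv).
rewrite linear_opB// uv subrr normr0 mulr0 normr_le0 => /eqP->.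
exact: rnorm0.
Qed.

Theorem corollary1p1 (R : realType) (H : completeNormedModType R[i])
    (dot : {dot H for Num.conj}) (L0 Lhat L LK : op H) (K : {linear H -> H}) :
  induces_norm dot ->
  linear_op L0 -> symmetric_op dot L0 -> minimal_op L0 ->
  op_eq Lhat (op_adj dot L0) -> maximal_op Lhat ->
  linear_op L -> self_adjoint dot L -> correct_op L -> restriction L0 L ->
  linear_op LK -> correct_op LK -> restriction LK Lhat ->
  bounded_op (op_total K) ->
  range K `<=` op_ker Lhat ->
  (forall f, op_inv LK f = op_inv L f + K f) ->
  op_range (op_adj dot (op_total K)) `<=` dom L ->
  nonneg_op dot (op_add (op_total idfun)
                        (op_closure (op_comp (op_total K) L))) ->
  invertible_op (op_add (op_total idfun)
                        (op_closure (op_comp (op_total K) L))) ->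
  spectrum LK `<=` [set x%:C | x in [set: R]].
Proof.
move=> dotP _ _ _ _ _ lL saL [Ls Lsurj] _ lLK [LKs LKsurj] _ Kb _ LKE KstL Snn
  [Sinj Ssurj [C SC]].
have Lsym := self_adjoint_symmetric saL.
have Linj := correctly_solvable_inj lL Ls.
have LKinj := correctly_solvable_inj lLK LKs.
pose Kst := op_adj dot (op_total K).
have KstP v u : dot (K u) v = dot u (Kst v) by have [_] := adjoint_total dotP Kb v.
have dKst v : dom L (Kst v).
  by apply: KstL; exists v => //; have [] := adjoint_total dotP Kb v.
pose KL := op_comp (op_total K) L.
have KL_adj u w : dom KL u -> dot (KL u) w = dot u (L (Kst w)).
  by move=> [du _]; rewrite /= KstP Lsym.
have [KL_sub KL_eq] := op_closure_restriction dotP KL_adj.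
pose B := op_add (op_total idfun) (op_closure KL).
pose S u := u + L (Kst u).
have BE u : B u = u + op_closure KL u by [].
have B_adj u w : dom B u -> dot (B u) w = dot u (S w).
  by move=> [_ du]; rewrite BE /S dotDl dotDr (op_closure_adjoint dotP KL_adj).
(* Symmetry is first obtained on D(L), a linear space on which the operator is
   given by the formula u + K (L u), and then carried over to the closure. *)
have lIKL : linear_op (Op (dom L) (fun u => u + K (L u))).
  split=> [|a u v|a u v du dv] /=; first exact: linear_op_dom0.
    exact: linear_op_domP.
  by rewrite linear_opP// linearP scalerDr addrACA.
have IKL_sym u v : dom L u -> dom L v ->
    dot (u + K (L u)) v = dot u (v + K (L v)).
  apply: (real_form_symmetric lIKL) => x dx /=.
  have dKL : dom KL x by [].
  have /Snn : dom B x by split=> //; exact: KL_sub.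
  by rewrite -/KL -/B BE -KL_eq// => /ger0_Im.
have KL_sym u v : dom KL u -> dom KL v -> dot (KL u) v = dot u (KL v).
  by move=> [du _] [dv _]; apply: (addrI (dot u v)); rewrite -dotDl -dotDr IKL_sym.
have B_sym u v : dom B u -> dom B v -> dot (B u) v = dot u (B v).
  move=> [_ du] [_ dv].
  by rewrite !BE dotDl dotDr (op_closure_symmetric dotP KL_sym).
have BS := surjective_symmetric_total dotP B_adj B_sym Ssurj.
have S_sym u v : dot (S u) v = dot u (S v).
  by have [du <-] := BS u; have [dv <-] := BS v; exact: B_sym.
have S_KL u : dom L u -> S u = u + K (L u).
  by move=> du; have [_ <-] := BS u; rewrite BE -KL_eq.
have [b Sb] : exists b, forall u, rnorm (S u) <= b * rnorm u.
  by apply: (symmetric_bounded dotP) => u v; rewrite /rdot S_sym.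
have [c c0 Sc] :
    exists2 c, 0 < c & forall u, c * rnorm u ^+ 2 <= rdot dot (S u) u.
  apply: (@coercive_of_bounded_inverse _ _ _ dotP S C S_sym) => [u|f|u].
  - by have [du <-] := BS u; exact: Snn.
  - have [u _ uf] : op_range B f by rewrite [op_range B]Ssurj.
    by exists u; rewrite -uf; case: (BS u).
  - have [du <-] := BS u; have {1}<- := op_inv_id Sinj du.
    by rewrite -le_rnorm; apply: SC; rewrite Ssurj.
(* L_K is L composed with the inverse of S. *)
have LKS u : dom L u -> dom LK (S u) /\ LK (S u) = L u.
  move=> du; have := op_invP (L u) LKsurj.
  by rewrite LKE op_inv_id// S_KL.
have LK_S v : dom LK v -> exists2 u, dom L u & v = S u.
  move=> dv; have [du uv] := op_invP (LK v) Lsurj.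
  exists (op_inv L (LK v)) => //.
  by rewrite S_KL// uv -LKE op_inv_id.
move=> z zsp; apply: contrapT => zreal; apply: zsp.
have z0 : complex.Im z != 0.
  apply/eqP => z0; apply: zreal; exists (complex.Re z) => //.
  by case: z z0 => ? ? /= ->.
pose T := op_add LK (op_total (fun u : H => - (z *: u))).
have TS u : dom L u -> dom T (S u) /\ T (S u) = L u - z *: S u.
  by move=> /LKS[d e]; rewrite /= e.
have lower u : dom L u ->
    rnorm u <= (c * `|complex.Im z|)^-1 * rnorm (L u - z *: S u).
  exact: (pencil_bounded_below dotP saL S_sym c0 Sc).
have onto f : exists2 u, dom L u & L u - z *: S u = f.
  exact: (pencil_onto dotP lL saL S_sym c0 Sc).
have Tinj : set_inj (dom T) T.
  move=> _ _ /set_mem[/LK_S[u du ->] _] /set_mem[/LK_S[v dv ->] _].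
  rewrite (TS _ du).2 (TS _ dv).2 => uv; congr S.
  apply/subr0_eq/rnorm0_eq0/eqP; rewrite eq_le rnorm_ge0 andbT.
  apply: le_trans (lower _ (linear_op_domB lL du dv)) _.
  have Sl := symmetric_linear dotP S_sym.
  have -> : S (u - v) = S u - S v.
    by rewrite addrC -scaleN1r Sl scaleN1r addrC.
  have -> : L (u - v) - z *: (S u - S v) = (L u - z *: S u) - (L v - z *: S v).
    by rewrite linear_opB// scalerBr !opprD !opprK addrACA.
  by rewrite uv subrr rnorm0 mulr0.
have Tsurj : op_range T = setT.
  apply/seteqP; split=> // f _; have [u du <-] := onto f.
  by exists (S u); case: (TS u du).
split=> //; exists (`|b| * (c * `|complex.Im z|)^-1) => f _.
rewrite le_rnorm; have [u du <-] := onto f.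
have [dTu <-] := TS u du; rewrite op_inv_id// (TS u du).2.
apply: le_trans (Sb u) _; rewrite -mulrA.
apply: (@le_trans _ _ (`|b| * rnorm u)).
  by rewrite ler_wpM2r ?rnorm_ge0// ler_norm.
by rewrite ler_wpM2l// lower.
Qed.
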